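(* Let $o\in X$ be a chosen root vertex. For $f \in L(X)$, the equation $\Delta u = f$ has a solution $u\in L(X)$ if and only if $$\int_X f\, d\pi := \sum_{x \in X} \pi(x)\,f(x) = 0 .$$ In this case, the unique solution $u$ with $u(o)=0$ is given by $u = - G_{X\setminus \{o\}}f$, that is, $$u(o)=0 \quad\text{and}\quad u(x) = -\sum_{y \in X\setminus \{o\}}\sum_{n=0}^{\infty} p_{X\setminus \{o\}}^{(n)}(x,y)f(y)\quad \text{for } x \in X\setminus \{o\},$$ and all solutions are given by $u(\cdot)+c$, where $c\in\mathbb{C}$.
   Context: Let $(X,E)$ be a finite directed graph with $|X|\ge 2$, $E\subset X^2$ without loops, which is strongly connected (for all $x,y\in X$ there is a directed path from $x$ to $y$). Each edge $(x,y)\in E$ carries a weight $a(x,y)>0$, and $a(x,y)=0$ if $(x,y)\notin E$. No symmetry is assumed. Put $m(x)=\sum_y a(x,y)$, $p(x,y)=a(x,y)/m(x)$, $P=(p(x,y))_{x,y\in X}$. $L(X)$ is the space of functions $X\to\mathbb{C}$ (column vectors), $Pu(x)=\sum_y p(x,y)u(y)$, and $\Delta=P-I$ is the Laplacian. $\pi$ denotes the unique stationary probability distribution of $P$: $\pi P=\pi$, $\pi(x)>0$ for all $x$, $\sum_x\pi(x)=1$. For $A\subsetneq X$, $P_A=(p(x,y))_{x,y\in A}$ is the restriction of $P$ to $A\times A$, $p_A^{(n)}(x,y)$ is the $(x,y)$-entry of $P_A^n$ (with $P_A^0=I_A$), and $G_A=(I_A-P_A)^{-1}=\sum_{n\ge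 0}P_A^n$ (the inverse exists and the series converges); $G_A$ is also viewed as a matrix over $X\times X$ with entries $0$ outside $A\times A$. *)

(* Defs.v *)
From HB Require Import structures.
From mathcomp Require Import all_boot all_order all_algebra.
From mathcomp Require Import all_classical all_reals all_analysis.
From mathcomp Require Import complex.

Set Implicit Arguments.
Unset Strict Implicit.
Unset Printing Implicit Defensive.

Import Order.TTheory GRing.Theory Num.Theory.
Import numFieldNormedType.Exports.

Local Open Scope ring_scope.
Local Open Scope complex_scope.

Section WeightedDigraph.
Variables (R : realType) (X : finType).

Definition weighted_digraph (E : rel X) (a : X -> X -> R) : Prop :=
  [/\ irreflexive E,
      forall x y, E x y -> 0 < a x y
    & forall x y, ~~ E x y -> a x y = 0].

Definition strongly_connected (E : rel X) : Prop :=
  forall x y, connect E x y.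

Variable a : X -> X -> R.

Definition total_weight (x : X) : R := \sum_y a x y.

Definition trans_prob (x y : X) : R := a x y / total_weight x.

(* The operator P on L(X) = {ffun X -> R[i]}; its kernel is real. *)
Definition trans_op (u : {ffun X -> R[i]}) : {ffun X -> R[i]} :=
  [ffun x => \sum_y (trans_prob x y)%:C * u y].

Definition laplacian (u : {ffun X -> R[i]}) : {ffun X -> R[i]} :=
  trans_op u - u.

Definition stationary_distribution (pi : X -> R) : Prop :=
  [/\ forall y, \sum_x pi x * trans_prob x y = pi y,
      forall x, 0 < pi x
    & \sum_x pi x = 1].

Definition integral_wrt (pi : X -> R) (f : {ffun X -> R[i]}) : R[i] :=
  \sum_x (pi x)%:C * f x.

(* Matrices over A x A are stored as 'M_#|A|, row i standing for the vertex
   enum_val i of A. *)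
Definition restr_mx (A : {set X}) : 'M[R]_#|A| :=
  \matrix_(i, j) trans_prob (enum_val i) (enum_val j).

(* The entry of M at (x, y): each sum has exactly one term when the vertex
   lies in A and is empty otherwise, so the entry is 0 outside A x A. *)
Definition entry (A : {set X}) (M : 'M[R]_#|A|) (x y : X) : R :=
  \sum_(i | enum_val i == x) \sum_(j | enum_val j == y) M i j.

Definition restr_prob (A : {set X}) (n : nat) (x y : X) : R :=
  entry (restr_mx A ^+ n) x y.

(* invmx M is M itself when M is singular, so this is the Green kernel only
   together with 1%:M - restr_mx A \in unitmx. *)
Definition green (A : {set X}) (x y : X) : R :=
  entry (invmx (1%:M - restr_mx A)) x y.

Definition green_op (A : {set X}) (f : {ffun X -> R[i]}) : {ffun X -> R[i]} :=
  [ffun x => \sum_y (green A x y)%:C * f y].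

(* R[i]^o is R[i] with the topology of the modulus. *)
Definition green_term (A : {set X}) (f : {ffun X -> R[i]}) (x y : X) (n : nat)
    : R[i]^o :=
  (restr_prob A n x y)%:C * f y.

End WeightedDigraph.

(* Main.v *)
Require Import Defs.
From HB Require Import structures.
From mathcomp Require Import all_boot all_order all_algebra.
From mathcomp Require Import all_classical all_reals all_analysis.
From mathcomp Require Import complex.

Set Implicit Arguments.
Unset Strict Implicit.
Unset Printing Implicit Defensive.

Import Order.TTheory GRing.Theory Num.Theory.
Import numFieldNormedType.Exports.

Local Open Scope classical_set_scope.
Local Open Scope ring_scope.
Local Open Scope complex_scope.

(** Everything rests on the maximum principle off the root: a real function
which at every vertex except [o] is at most its [P]-average attains its
maximum at [o], because the set where it is maximal is closed under following
edges until [o] is met, and [o] can be reached from everywhere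
([maximum_principle]).  Hence a function harmonic off [o] is constant
([harmonic_off_root_constant] for real functions, [laplacian_ker] for complex
ones).

With [A = X \ {o}], this makes [I - P_A] injective, hence invertible
([restr_mx_unit]).  The Neumann series then converges to the inverse: its
partial sums are [G_A - P_A^n G_A], and [P_A^n] tends to 0 because the row
sums of [P_A^n] decrease to a fixed vector of [P_A], which must vanish
([substochastic_pow_cvg0], [neumann_series]).

The function [u0 = - G_A f] vanishes at [o] and solves the equation at each
vertex of [A], by [(I - P_A) G_A = I] ([laplacian_green_op]).  Stationarity
says that every Laplacian has integral 0 against [pi] ([integral_laplacian]);
this gives the necessity of the condition on [f].  Conversely, if [f] also has
integral 0, then so does the defect of [u0], which is supported at [o]; since
[pi o > 0], the equation holds at [o] too.  Two solutions differ by a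
harmonic function, that is, by a constant. *)

(** * Maximum principle off a root *)

(** At a maximum point [x <> o], the average of the nonnegative gaps
[h x0 - h z] is nonpositive, so every out-neighbour of [x] is again a maximum
point; a path to [o] carries the maximum to [o]. *)
Lemma maximum_principle (R : realType) (X : finType) (p : X -> X -> R) (o : X)
    (h : X -> R) :
  (forall x y, 0 <= p x y) -> (forall x, \sum_y p x y = 1) ->
  (forall x, connect (fun x y => 0 < p x y) x o) ->
  (forall x, x != o -> h x <= \sum_y p x y * h y) ->
  forall x, h x <= h o.
Proof.
move=> p_ge0 p_sum1 to_o h_sub.
pose x0 := [arg max_(x > o) h x]%O.
have x0_max x : h x <= h x0.
  by rewrite /x0; case: arg_maxP => // i _; apply.
suff h_o : h o = h x0 by move=> x; rewrite h_o.
have step x y : x != o -> h x = h x0 -> 0 < p x y -> h y = h x0.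
  move=> xo hx pxy.
  have gap_ge0 z : true -> 0 <= p x z * (h x0 - h z).
    by move=> _; rewrite mulr_ge0 ?subr_ge0.
  have gap_sum : \sum_z p x z * (h x0 - h z) = 0.
    apply/le_anti; rewrite sumr_ge0 // andbT.
    under eq_bigr do rewrite mulrBr.
    by rewrite sumrB -mulr_suml p_sum1 mul1r subr_le0 -[leLHS]hx h_sub.
  have /eqP : p x y * (h x0 - h y) = 0 by exact: (psumr_eq0P gap_ge0 gap_sum).
  by rewrite mulf_eq0 gt_eqF //= subr_eq0 eq_sym => /eqP.
have /connectP[s] := to_o x0.
have : h x0 = h x0 by [].
elim: s {1 3 4}x0 => [|y s IHs] x hx /=; first by move=> _ ->.
(* At [x = o] the claim is the hypothesis that [x] is a maximum point. *)
have [<- //|xo] := eqVneq x o.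
by case/andP=> /(step _ _ xo hx)/IHs.
Qed.

(** The maximum principle applies to both [h] and [- h]. *)
Lemma harmonic_off_root_constant (R : realType) (X : finType)
    (p : X -> X -> R) (o : X) (h : X -> R) :
  (forall x y, 0 <= p x y) -> (forall x, \sum_y p x y = 1) ->
  (forall x, connect (fun x y => 0 < p x y) x o) ->
  (forall x, x != o -> \sum_y p x y * h y = h x) ->
  forall x, h x = h o.
Proof.
move=> p_ge0 p_sum1 to_o h_harm x; apply/le_anti/andP; split.
  by apply: maximum_principle => // y /h_harm ->.
rewrite -lerN2; apply: (@maximum_principle _ _ p o (fun x => - h x)) => // y yo.
by under eq_bigr do rewrite mulrN; rewrite sumrN h_harm.
Qed.

(** * Neumann series of a substochastic matrix *)

Lemma mx_pow_ge0 (R : realType) n (Q : 'M[R]_n) :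
  (forall i j, 0 <= Q i j) -> forall k i j, 0 <= (Q ^+ k) i j.
Proof.
move=> Q_ge0; elim=> [|k IHk] i j; first by rewrite expr0 mxE ler0n.
by rewrite exprS -mulmxE mxE sumr_ge0 // => l _; rewrite mulr_ge0.
Qed.

(** The row sums [w k] of [Q ^+ k] satisfy [w k.+1 = Q w k] and decrease in
[k], so they converge, and their limit is fixed by [Q]; since [1 - Q] is
invertible the limit is 0.  The row sums dominate the entries. *)
Lemma substochastic_pow_cvg0 (R : realType) n (Q : 'M[R]_n) :
  (forall i j, 0 <= Q i j) -> (forall i, \sum_j Q i j <= 1) ->
  1%:M - Q \in unitmx ->
  forall i j, (fun k => (Q ^+ k) i j) @ \oo --> 0.
Proof.
move=> Q_ge0 Q_sum1 Q_unit i j.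
have pow_ge0 := mx_pow_ge0 Q_ge0.
pose w k i := \sum_j (Q ^+ k) i j.
have w_ge0 k l : 0 <= w k l by rewrite sumr_ge0.
have w_rec k l : w k.+1 l = \sum_m Q l m * w k m.
  rewrite /w; under eq_bigr do rewrite exprS -mulmxE mxE.
  by rewrite exchange_big; apply: eq_bigr => m _; rewrite mulr_sumr.
have w_dec l : nonincreasing_seq (w ^~ l).
  apply/nonincreasing_seqP => k.
  rewrite /w; under eq_bigr do rewrite exprSr -mulmxE mxE.
  rewrite exchange_big ler_sum // => m _.
  by rewrite -mulr_sumr ler_piMr.
have w_cvg l : cvgn (w ^~ l).
  apply: nonincreasing_is_cvgn; first exact: w_dec.
  by exists 0 => _ [k _ <-].
pose W : 'cV[R]_n := \col_l limn (w ^~ l).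
have W_fix : (1%:M - Q) *m W = 0.
  apply/matrixP => l z; rewrite mulmxBl mul1mx !mxE; apply/eqP.
  rewrite subr_eq0; apply/eqP.
  have lim1 : (fun k => w k.+1 l) @ \oo --> limn (w ^~ l).
    by rewrite (cvg_shiftS (w ^~ l)); apply: w_cvg.
  have lim2 : (fun k => w k.+1 l) @ \oo --> \sum_m Q l m * W m z.
    under eq_fun do rewrite w_rec.
    apply: cvg_big => [|m _]; first exact: add_continuous.
    by apply: cvgMl_tmp; rewrite mxE; apply: w_cvg.
  exact: (cvg_unique (@Rhausdorff R) lim1 lim2).
have W0 : W = 0 by rewrite -(mulKmx Q_unit W) W_fix mulmx0.
have w_cvg0 : w ^~ i @ \oo --> 0.
  by have /matrixP/(_ i 0) := W0; rewrite !mxE => <-; apply: w_cvg.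
apply: squeeze_cvgr (cvg_cst 0) w_cvg0.
by apply: nearW => k; rewrite pow_ge0 /w (bigD1 j) //= lerDl sumr_ge0.
Qed.

(** The telescoping identity expresses the partial sum of order [k] as
[G - Q ^+ k *m G], where the second term tends to 0. *)
Lemma neumann_series (R : realType) n (Q : 'M[R]_n) :
  (forall i j, 0 <= Q i j) -> (forall i, \sum_j Q i j <= 1) ->
  1%:M - Q \in unitmx ->
  forall i j,
    series (fun k => (Q ^+ k) i j) @ \oo --> invmx (1%:M - Q) i j.
Proof.
move=> Q_ge0 Q_sum1 Q_unit i j; set G := invmx _.
have partial k : \sum_(0 <= l < k) Q ^+ l = G - Q ^+ k *m G.
  suff tele : (\sum_(0 <= l < k) Q ^+ l) *m (1%:M - Q) = 1%:M - Q ^+ k.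
    by rewrite -[LHS](mulmxK Q_unit) -/G tele mulmxBl mul1mx.
  elim: k => [|k IHk].
    by rewrite big_nil mul0mx expr0 subrr.
  rewrite big_nat_recr //= mulmxDl IHk mulmxBr mulmx1 addrA subrK.
  by rewrite exprSr.
have -> : series (fun k => (Q ^+ k) i j) =
          (fun k => G i j - \sum_l (Q ^+ k) i l * G l j).
  apply/funext => k; rewrite /series /=.
  have /matrixP/(_ i j) := partial k.
  by rewrite summxE => ->; rewrite !mxE.
rewrite -[X in _ --> X]subr0; apply: cvgB; first exact: cvg_cst.
rewrite -[X in _ --> X](_ : \sum_l 0 * G l j = 0); last first.
  by rewrite big1 // => l _; rewrite mul0r.
apply: cvg_big => [|l _]; first exact: add_continuous.
by apply: cvgMr_tmp; apply: substochastic_pow_cvg0.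
Qed.

(** * Transition probabilities of a strongly connected weighted digraph *)

Lemma weight_ge0 (R : realType) (X : finType) (E : rel X) (a : X -> X -> R) :
  weighted_digraph E a -> forall x y, 0 <= a x y.
Proof.
case=> _ a_gt0 a_eq0 x y.
by have [/a_gt0/ltW|/a_eq0->] := boolP (E x y).
Qed.

Lemma trans_prob_ge0 (R : realType) (X : finType) (E : rel X)
    (a : X -> X -> R) :
  weighted_digraph E a -> forall x y, 0 <= trans_prob a x y.
Proof.
move=> /weight_ge0 a_ge0 x y.
by rewrite divr_ge0 // sumr_ge0.
Qed.

(** Since [x] is not the only vertex, the first edge of a path from [x] to
another vertex leaves [x]. *)
Lemma total_weight_gt0 (R : realType) (X : finType) (E : rel X)
    (a : X -> X -> R) :
  (2 <= #|X|)%N -> weighted_digraph E a -> strongly_connected E ->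
  forall x, 0 < total_weight a x.
Proof.
move=> X_ge2 Ea E_conn x; have a_ge0 := weight_ge0 Ea.
case: Ea => _ a_gt0 _.
have [y yx] : exists y, y != x.
  apply/existsP; apply: contraTT X_ge2; rewrite negb_exists -leqNgt.
  move=> /forallP eqx.
  rewrite -(card1 x); apply: subset_leq_card.
  by apply/fintype.subsetP => y _; rewrite inE; apply: negbNE.
have /connectP[[|z s] /= path_s last_s] := E_conn x y.
  by rewrite last_s eqxx in yx.
case/andP: path_s => /a_gt0 a_xz _.
by rewrite /total_weight (bigD1 z) //= ltr_wpDr // sumr_ge0.
Qed.

Lemma trans_prob_sum1 (R : realType) (X : finType) (a : X -> X -> R) x :
  0 < total_weight a x -> \sum_y trans_prob a x y = 1.
Proof. by move=> m_gt0; rewrite -mulr_suml divff // gt_eqF. Qed.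

Lemma trans_prob_connect (R : realType) (X : finType) (E : rel X)
    (a : X -> X -> R) :
  (2 <= #|X|)%N -> weighted_digraph E a -> strongly_connected E ->
  forall x y, connect (fun x y => 0 < trans_prob a x y) x y.
Proof.
move=> X_ge2 Ea E_conn x y.
apply: connect_sub (E_conn x y) => {x y} x y Exy; apply: connect1.
rewrite divr_gt0 //; first by case: Ea => _ a_gt0 _; apply: a_gt0.
exact: total_weight_gt0 X_ge2 Ea E_conn x.
Qed.

(** * Restriction to a set of vertices and the Green kernel *)

Lemma sum_enum_val_eq (X : finType) (V : nmodType) (A : {set X})
    (F : 'I_#|A| -> V) i :
  \sum_(j | enum_val j == enum_val i) F j = F i.
Proof. by rewrite (big_pred1 i) // => j; rewrite (inj_eq enum_val_inj). Qed.

Lemma sum_enum_val_notin (X : finType) (V : nmodType) (A : {set X})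
    (F : 'I_#|A| -> V) x :
  x \notin A -> \sum_(j | enum_val j == x) F j = 0.
Proof.
move=> xA; rewrite big_pred0 // => j; apply: contraNF xA => /eqP <-.
exact: enum_valP.
Qed.

Lemma sum_support (X : finType) (V : nmodType) (A : {set X}) (F : X -> V) :
  (forall x, x \notin A -> F x = 0) ->
  \sum_x F x = \sum_(i < #|A|) F (enum_val i).
Proof.
by move=> F0; rewrite (bigID (mem A)) /= [X in _ + X]big1 // addr0 big_enum_val.
Qed.

Lemma entry_enum_val (R : realType) (X : finType) (A : {set X})
    (M : 'M[R]_#|A|) i j :
  entry M (enum_val i) (enum_val j) = M i j.
Proof. by rewrite /entry !sum_enum_val_eq. Qed.

Lemma entry_notin_l (R : realType) (X : finType) (A : {set X})
    (M : 'M[R]_#|A|) x y :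
  x \notin A -> entry M x y = 0.
Proof. exact: sum_enum_val_notin. Qed.

Lemma entry_notin_r (R : realType) (X : finType) (A : {set X})
    (M : 'M[R]_#|A|) x y :
  y \notin A -> entry M x y = 0.
Proof.
by move=> yA; rewrite /entry big1 // => i _; rewrite sum_enum_val_notin.
Qed.

(** The hypothesis is uniqueness for the Dirichlet problem with zero data
outside [A].  A vector in the kernel of [I - P_A], extended by 0 to [X], is a
solution of that problem. *)
Lemma restr_mx_unit (R : realType) (X : finType) (a : X -> X -> R)
    (A : {set X}) :
  (forall h : X -> R,
     (forall x, x \notin A -> h x = 0) ->
     (forall x, x \in A -> \sum_y trans_prob a x y * h y = h x) ->
     forall x, h x = 0) ->
  1%:M - restr_mx a A \in unitmx.
Proof.
(* [det0P] speaks of row vectors, whereas [P_A] acts on columns. *)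
move=> dirichlet0; rewrite unitmxE unitfE -det_tr; apply/negP => /det0P[v].
move=> /negP v_neq0 v_ker; apply: v_neq0.
pose h x := \sum_(i | enum_val i == x) v 0 i.
have h0 : forall x, h x = 0.
  apply: dirichlet0 => [x|x xA]; first exact: sum_enum_val_notin.
  rewrite (@sum_support _ _ A); last first.
    by move=> y yA; rewrite /h sum_enum_val_notin ?mulr0.
  rewrite -(enum_rankK_in xA xA); set i := enum_rank_in _ _.
  rewrite {2}/h sum_enum_val_eq.
  have /matrixP/(_ 0 i)/eqP := v_ker.
  rewrite linearB /= trmx1 mulmxBr mulmx1 !mxE subr_eq0 => /eqP ->.
  by apply: eq_bigr => j _; rewrite /h sum_enum_val_eq !mxE mulrC.
apply/eqP/rowP => i; rewrite mxE -(h0 (enum_val i)).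
by rewrite /h sum_enum_val_eq.
Qed.

(** This is [P_A G_A = G_A - I] read on [X], where the sum may run over all
of [X] because the Green kernel vanishes outside [A]. *)
Lemma green_equation (R : realType) (X : finType) (a : X -> X -> R)
    (A : {set X}) x z :
  1%:M - restr_mx a A \in unitmx -> x \in A -> z \in A ->
  \sum_y trans_prob a x y * green a A y z = green a A x z - (x == z)%:R.
Proof.
move=> Q_unit xA zA; rewrite (@sum_support _ _ A); last first.
  by move=> y yA; rewrite /green entry_notin_l ?mulr0.
rewrite -(enum_rankK_in xA xA) -(enum_rankK_in zA zA).
set i := enum_rank_in _ _; set k := enum_rank_in _ _.
have /matrixP/(_ i k) := mulmxV Q_unit.
rewrite mulmxBl mul1mx /green entry_enum_val !mxE (inj_eq enum_val_inj) => <-.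
rewrite subKr.
by apply: eq_bigr => j _; rewrite entry_enum_val mxE.
Qed.

(** An entry over [X] is a finite sum of matrix entries, so the Neumann series
gives convergence both inside [A] and, trivially, outside. *)
Lemma restr_prob_series (R : realType) (X : finType) (a : X -> X -> R)
    (A : {set X}) :
  (forall x y, 0 <= trans_prob a x y) ->
  (forall x, \sum_y trans_prob a x y <= 1) ->
  1%:M - restr_mx a A \in unitmx ->
  forall x y,
    series (fun n => restr_prob a A n x y) @ \oo --> green a A x y.
Proof.
move=> p_ge0 p_sum1 Q_unit x y.
have Q_ge0 i j : 0 <= restr_mx a A i j by rewrite mxE.
have Q_sum1 i : \sum_j restr_mx a A i j <= 1.
  apply: le_trans (p_sum1 (enum_val i)).
  under eq_bigr do rewrite mxE.
  rewrite -(big_enum_val (trans_prob a (enum_val i))) [leRHS](bigID (mem A)) /=.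
  by rewrite lerDl sumr_ge0.
have -> : series (fun n => restr_prob a A n x y) =
    (fun n => \sum_(i | enum_val i == x) \sum_(j | enum_val j == y)
                series (fun n => (restr_mx a A ^+ n) i j) n).
  apply/funext => n; rewrite /series /= /restr_prob /entry exchange_big.
  by apply: eq_bigr => i _; rewrite exchange_big.
apply: cvg_big => [|i _]; first exact: add_continuous.
apply: cvg_big => [|j _]; first exact: add_continuous.
exact: neumann_series.
Qed.

(** * Complex functions *)

(** The embedding of the reals is an isometry for the modulus. *)
Lemma cvg_real_complexMr (R : realType) (s : nat -> R) (l : R) (c : R[i]) :
  s @ \oo --> l ->
  (fun n => (s n)%:C * c : R[i]^o) @ \oo --> (l%:C * c : R[i]^o).
Proof.
move=> s_l; apply: (@cvgMr_tmp R[i]).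
(* A positive element of [R[i]] is a positive real: its imaginary part is 0. *)
apply/cvgrPdist_lt => eps; rewrite ltcE /= => /andP[/eqP im0 re_gt0].
move/cvgrPdist_lt/(_ _ re_gt0): s_l; apply: filterS => n.
rewrite -(rmorphB (real_complex R)) normc_def /= expr0n addr0 sqrtr_sqr.
by rewrite ltcE /= im0 eqxx.
Qed.

Lemma green_term_series (R : realType) (X : finType) (a : X -> X -> R)
    (A : {set X}) (f : {ffun X -> R[i]}) x y :
  series (fun n => restr_prob a A n x y) @ \oo --> green a A x y ->
  series (green_term a A f x y) @ \oo --> ((green a A x y)%:C * f y : R[i]^o).
Proof.
move=> /(@cvg_real_complexMr _ _ _ (f y)).
rewrite (_ : series (green_term a A f x y) = (fun n => (series (fun k =>
  restr_prob a A k x y) n)%:C * f y)) //.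
by apply/funext => n; rewrite /series /= rmorph_sum mulr_suml.
Qed.

Lemma laplacianB (R : realType) (X : finType) (a : X -> X -> R)
    (u v : {ffun X -> R[i]}) :
  laplacian a (u - v) = laplacian a u - laplacian a v.
Proof.
rewrite /laplacian.
have -> : trans_op a (u - v) = trans_op a u - trans_op a v.
  apply/ffunP => x; rewrite !ffunE -sumrB.
  by apply: eq_bigr => y _; rewrite !ffunE mulrBr.
by rewrite !opprB addrACA [RHS]addrACA [- u - _]addrC.
Qed.

Lemma laplacian_cst (R : realType) (X : finType) (a : X -> X -> R) (c : R[i]) :
  (forall x, \sum_y trans_prob a x y = 1) -> laplacian a [ffun=> c] = 0.
Proof.
move=> p_sum1; apply/ffunP => x; rewrite !ffunE.
under eq_bigr do rewrite ffunE.
by rewrite -mulr_suml -rmorph_sum p_sum1 mul1r subrr.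
Qed.

Lemma laplacian_green_op (R : realType) (X : finType) (a : X -> X -> R)
    (A : {set X}) (f : {ffun X -> R[i]}) x :
  1%:M - restr_mx a A \in unitmx -> x \in A ->
  laplacian a (green_op a A f) x = - f x.
Proof.
move=> Q_unit xA; rewrite !ffunE.
under eq_bigr do rewrite ffunE mulr_sumr.
rewrite exchange_big -sumrB (bigD1 x) //= [X in _ + X]big1 ?addr0.
- under eq_bigr do rewrite mulrA -rmorphM.
  rewrite -mulr_suml -rmorph_sum green_equation // eqxx -mulrBl -rmorphB.
  by rewrite addrC addKr rmorphN1 mulN1r.
move=> z zx; under eq_bigr do rewrite mulrA -rmorphM.
rewrite -mulr_suml -rmorph_sum -mulrBl -rmorphB.
have [zA|zA] := boolP (z \in A).
  by rewrite green_equation // eq_sym (negPf zx) subr0 subrr mul0r.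
rewrite big1 => [|y _]; rewrite /green !entry_notin_r ?mulr0 //.
by rewrite subrr mul0r.
Qed.

(** Exchanging the sums turns the integral of [P u] into the integral of [u]
against [pi P = pi]. *)
Lemma integral_laplacian (R : realType) (X : finType) (a : X -> X -> R)
    (pi : X -> R) (u : {ffun X -> R[i]}) :
  stationary_distribution a pi -> integral_wrt pi (laplacian a u) = 0.
Proof.
case=> pi_P _ _; rewrite /integral_wrt.
under eq_bigr do rewrite !ffunE mulrBr mulr_sumr.
rewrite sumrB exchange_big /=; apply/eqP; rewrite subr_eq0; apply/eqP.
apply: eq_bigr => y _; under eq_bigr do rewrite mulrA -rmorphM.
by rewrite -mulr_suml -rmorph_sum pi_P.
Qed.

(** The kernel of [P] being real, the real and imaginary parts are harmonic
off [o] separately. *)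
Lemma laplacian_ker (R : realType) (X : finType) (a : X -> X -> R) (o : X)
    (u : {ffun X -> R[i]}) :
  (forall x y, 0 <= trans_prob a x y) ->
  (forall x, \sum_y trans_prob a x y = 1) ->
  (forall x, connect (fun x y => 0 < trans_prob a x y) x o) ->
  (forall x, x != o -> laplacian a u x = 0) ->
  forall x, u x = u o.
Proof.
move=> p_ge0 p_sum1 to_o u_harm x.
have real_part (g : R[i] -> R) : {morph g : z w / z + w} -> g 0 = 0 ->
    (forall (r : R) z, g (r%:C * z) = r * g z) -> g (u x) = g (u o).
  move=> gD g0 gZ.
  apply: (harmonic_off_root_constant (h := g \o u) p_ge0) => //.
  move=> y /u_harm/eqP; rewrite !ffunE subr_eq0 => /eqP /(congr1 g) /=.
  by rewrite (big_morph g gD g0) => <-; apply: eq_bigr => z _; rewrite gZ.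
apply/eqP; rewrite eq_complex.
apply/andP; split; apply/eqP; apply: real_part => //.
- by case=> ? ? [].
- by move=> r [] ? ? /=; rewrite mul0r subr0.
- by case=> ? ? [].
- by move=> r [] ? ? /=; rewrite mul0r addr0.
Qed.

(** * The Poisson equation *)

Theorem mainTheorem1 (R : realType) (X : finType) (E : rel X)
    (a : X -> X -> R) (pi : X -> R) (o : X) (f : {ffun X -> R[i]})
    (card_X : (2 <= #|X|)%N)
    (Ea : weighted_digraph E a)
    (E_conn : strongly_connected E)
    (pi_stat : stationary_distribution a pi) :
  let A : {set X} := [set~ o]%SET in
  let u0 : {ffun X -> R[i]} := - green_op a A f in
  [/\ 1%:M - restr_mx a A \in unitmx,
      forall x y : X,
        series (fun n => restr_prob a A n x y) @ \oo --> green a A x y,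
      (exists u : {ffun X -> R[i]}, laplacian a u = f)
        <-> integral_wrt pi f = 0
    & integral_wrt pi f = 0 ->
      [/\ forall u : {ffun X -> R[i]},
            laplacian a u = f /\ u o = 0 <-> u = u0,
          u0 o = 0,
          forall x : X, x \in A ->
            (forall y : X, y \in A -> cvgn (series (green_term a A f x y))) /\
            u0 x = - \sum_(y in A) limn (series (green_term a A f x y))
        & forall u : {ffun X -> R[i]},
            laplacian a u = f <-> exists c : R[i], u = u0 + [ffun=> c]]].
Proof.
move=> A u0.
have p_ge0 := trans_prob_ge0 Ea.
have p_sum1 x := trans_prob_sum1 (total_weight_gt0 card_X Ea E_conn x).
have to_o x := trans_prob_connect card_X Ea E_conn x o.
have inA x : (x \in A) = (x != o) by rewrite !inE.
have oA : o \notin A by rewrite inA negbK.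
have Q_unit : 1%:M - restr_mx a A \in unitmx.
  apply: restr_mx_unit => h h_out h_harm x; rewrite -(h_out o oA).
  by apply: (harmonic_off_root_constant p_ge0) => // y; rewrite -inA => /h_harm.
have G_series : forall x y,
    series (fun n => restr_prob a A n x y) @ \oo --> green a A x y.
  by apply: restr_prob_series => // x; rewrite p_sum1.
have lap0 : laplacian a 0 = 0.
  by rewrite -[X in laplacian _ X](subrr 0) laplacianB subrr.
have u0o : u0 o = 0.
  rewrite !ffunE big1 ?oppr0 // => y _.
  by rewrite /green entry_notin_l // mul0r.
(* The defect [laplacian a u0 - f] vanishes off [o], so its integral is [pi o]
   times its value at [o]. *)
have solvable_u0 : integral_wrt pi f = 0 -> laplacian a u0 = f.
  move=> f_int0; apply/eqP; rewrite -subr_eq0; apply/eqP/ffunP => x.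
  have off_o y : y != o -> (laplacian a u0 - f) y = 0.
    rewrite -inA => yA; rewrite /u0 -[- _]add0r laplacianB lap0 sub0r.
    rewrite [LHS]ffunE [X in X + _]ffunE [X in _ + X]ffunE.
    by rewrite laplacian_green_op // opprK subrr.
  have [->|/off_o ->] := eqVneq x o; last by rewrite ffunE.
  have int0 : integral_wrt pi (laplacian a u0 - f) = 0.
    rewrite -[RHS](subrr 0) -{1}(integral_laplacian u0 pi_stat) -f_int0.
    rewrite /integral_wrt -sumrB; apply: eq_bigr => y _.
    by rewrite -mulrBr [X in _ * X = _]ffunE [X in _ + X]ffunE.
  move: int0; rewrite /integral_wrt (bigD1 o) //= big1 ?addr0; last first.
    by move=> y /off_o ->; rewrite mulr0.
  case: pi_stat => _ pi_gt0 _ /eqP; rewrite mulf_eq0 (fmorph_eq0 (real_complex R)).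
  by rewrite gt_eqF //= => /eqP ->; rewrite ffunE.
have sol_const u : laplacian a u = f -> integral_wrt pi f = 0 ->
    u = u0 + [ffun=> u o].
  move=> lap_u f_int0; apply/ffunP => x.
  have diff_cst : (u - u0) x = (u - u0) o.
    apply: (laplacian_ker p_ge0) => // y _.
    by rewrite laplacianB lap_u solvable_u0 // subrr ffunE.
  move: diff_cst; rewrite [LHS]ffunE [RHS]ffunE [X in _ + X = _]ffunE.
  rewrite [X in _ = _ + X]ffunE u0o subr0 => <-.
  by rewrite [RHS]ffunE [X in _ = _ + X]ffunE addrC subrK.
split => //.
  split=> [[u <-]|/solvable_u0 ?]; last by exists u0.
  exact: integral_laplacian.
move=> f_int0; split => //.
- move=> u; split=> [[lap_u u_o]| ->]; last by rewrite solvable_u0.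
  rewrite (sol_const u lap_u f_int0) u_o.
  by apply/ffunP => x; rewrite [LHS]ffunE [X in _ + X]ffunE addr0.
- move=> x xA; have term_cvg y := green_term_series (f := f) (G_series x y).
  split=> [y _|]; first by apply/cvg_ex; eexists; apply: term_cvg.
  rewrite !ffunE; congr (- _).
  rewrite (bigID (mem A)) /= [X in _ + X]big1 ?addr0; last first.
    by move=> y yA; rewrite /green entry_notin_r // mul0r.
  apply: eq_bigr => y _; apply/esym/(@cvg_lim R[i]^o); last exact: term_cvg.
  exact: norm_hausdorff.
- move=> u; split=> [lap_u|[c ->]]; first by exists (u o); apply: sol_const.
  rewrite -[[ffun=> c]]opprK laplacianB -[X in _ - laplacian _ X]add0r.
  by rewrite laplacianB lap0 laplacian_cst // solvable_u0 // !subr0.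
Qed.
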